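(* Let $\mathbb P$ be a stationary probability measure on $\mathcal N$ with finite intensity, and suppose $\mathbb P$ has finite range of dependence. Then there exists $p_*\in(0,1)$ such that for every $p\in[0,p_*]$, $\mathbb Q$-almost surely the graph $\mathcal G(\xi,W)$ has only bounded connected components.
   Context: $\mathcal N$ = locally finite subsets of $\mathbb R^d$, identified with counting measures ($\xi(A)=\#(\xi\cap A)$), with $\sigma$-algebra generated by $\xi\mapsto\xi(A)$; $\tau_x\xi:=\xi-x$; stationarity means $\mathbb P(\tau_xA)=\mathbb P(A)$ for all $x,A$; the intensity is $\mathbb E[\xi([0,1]^d)]$. $\mathrm{Vor}(x|\xi)=\{y:|y-x|\le|y-z|\ \forall z\in\xi\}$. $\mathcal N_{\rm pol}$ is the set of $\xi\in\mathcal N$ all of whose Voronoi cells are convex polytopes (bounded polyhedra); a stationary $\mathbb P$ satisfies $\mathbb P(\mathcal N_{\rm pol})=1$. $\mathrm{DT}(\xi)$ is the graph on $\xi$ with edge set $\mathcal E_{\rm DT}(\xi)$ consisting of pairs $\{x,y\}$, $x\ne y$, whose Voronoi cells share a $(d-1)$-dimensional face. Finite range of dependence: $\exists L>0$ such that $\xi\cap A$ and $\xi\cap B$ are $\mathbb P$-independent for Borel $A,B$ at distance $\ge L$. Bernoulli bond percolation on $\mathrm{DT}$: for $p\in[0,1]$, $\mathbb Q$ is the probability on $\mathcal X=\{(\xi,W):\xi\in\mathcal N_{\rm pol},W\in\{0,1\}^{\mathcal E_{\rm DT}(\xi)}\}$ under which $\xi$ has law $\mathbb P$ restricted to $\mathcal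 N_{\rm pol}$ and, given $\xi$, the $W_{x,y}$ are i.i.d. Bernoulli($p$). $\mathcal G(\xi,W)$ is the graph with vertex set $\xi$ and edges the $\{x,y\}\in\mathcal E_{\rm DT}(\xi)$ with $W_{x,y}=1$. *)

(* Defs.v *)
From HB Require Import structures.
From mathcomp Require Import all_boot all_order all_algebra.
From mathcomp Require Import all_classical all_reals all_analysis.
From mathcomp Require Import finmap.
From Stdlib Require Import Relations.

Set Implicit Arguments.
Unset Strict Implicit.
Unset Printing Implicit Defensive.

Import Order.TTheory GRing.Theory Num.Theory.
Import numFieldTopology.Exports numFieldNormedType.Exports.
Local Open Scope classical_set_scope.
Local Open Scope ring_scope.

Definition dotv (R : realType) (d : nat) (u v : 'rV[R]_d) : R :=
  \sum_(i < d) u 0 i * v 0 i.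

Definition dist2 (R : realType) (d : nat) (x y : 'rV[R]_d) : R := dotv (x - y) (x - y).

Definition ebounded (R : realType) (d : nat) (A : set 'rV[R]_d) : Prop :=
  exists r : R, forall y, A y -> dist2 y 0 <= r.

Definition borel_set (R : realType) (d : nat) (A : set 'rV[R]_d) : Prop :=
  <<s [set U : set 'rV[R]_d | open U] >> A.

Definition locally_finite (R : realType) (d : nat) (xi : set 'rV[R]_d) : Prop :=
  forall B, ebounded B -> finite_set (xi `&` B).

Record lfset (R : realType) (d : nat) := LFSet {
  pts : set 'rV[R]_d;
  pts_lf : locally_finite pts }.

Lemma locally_finite0 (R : realType) (d : nat) : locally_finite (@set0 'rV[R]_d).
Proof. by move=> B _; rewrite set0I; exact: finite_set0. Qed.

HB.instance Definition _ (R : realType) (d : nat) := gen_eqMixin (lfset R d).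
HB.instance Definition _ (R : realType) (d : nat) := gen_choiceMixin (lfset R d).
HB.instance Definition _ (R : realType) (d : nat) :=
  isPointed.Build (lfset R d) (LFSet (@locally_finite0 R d)).

(* generators: the sets {xi | xi(A) = n}, A Borel, n in N ; the sigma-algebra
   they generate is the one generated by the maps xi |-> xi(A) (values in N u {oo}) *)
Definition count_gens (R : realType) (d : nat) : set (set (lfset R d)) :=
  [set E | exists (A : set 'rV[R]_d) (n : nat),
     borel_set A /\ E = [set xi | ((pts xi `&` A) #= [set k : nat | (k < n)%N])%card]].

Definition Nspace (R : realType) (d : nat) : measurableType _ :=
  g_sigma_algebraType (@count_gens R d).

Definition npoints (R : realType) (d : nat) (S : set 'rV[R]_d) : \bar R :=
  if pselect (finite_set S) is left _ then ((#|` fset_set S|)%:R)%:E else +oo%E.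

Definition unit_cube (R : realType) (d : nat) : set 'rV[R]_d :=
  [set y | forall i, 0 <= y 0 i <= 1].

Definition translate (R : realType) (d : nat) (x : 'rV[R]_d) (S : set 'rV[R]_d) :=
  [set y - x | y in S].

Definition stationary (R : realType) (d : nat) (P : probability (Nspace R d) R) :=
  forall (x : 'rV[R]_d) (A : set (Nspace R d)), measurable A ->
    P [set eta : Nspace R d | exists2 xi : Nspace R d, A xi &
                                pts eta = translate x (pts xi)] = P A.

Definition finite_intensity (R : realType) (d : nat) (P : probability (Nspace R d) R) :=
  (\int[P]_xi npoints (pts (xi : Nspace R d) `&` @unit_cube R d) < +oo)%E.

Lemma locally_finiteI (R : realType) (d : nat) (xi A : set 'rV[R]_d) :
  locally_finite xi -> locally_finite (xi `&` A).
Proof.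
move=> h B bB; apply: (sub_finite_set _ (h B bB)).
by move=> y [[? _] ?].
Qed.

Definition restrict (R : realType) (d : nat) (A : set 'rV[R]_d) (xi : Nspace R d)
  : Nspace R d := LFSet (locally_finiteI A (pts_lf xi)).

Definition finite_range_dependence (R : realType) (d : nat)
    (P : probability (Nspace R d) R) :=
  exists L : R, 0 < L /\
    forall A B : set 'rV[R]_d, borel_set A -> borel_set B ->
      (forall a b, A a -> B b -> L ^+ 2 <= dist2 a b) ->
      forall E1 E2 : set (Nspace R d), measurable E1 -> measurable E2 ->
        P (restrict A @^-1` E1 `&` restrict B @^-1` E2) =
        (P (restrict A @^-1` E1) * P (restrict B @^-1` E2))%E.

Definition Vor (R : realType) (d : nat) (x : 'rV[R]_d) (xi : set 'rV[R]_d) :=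
  [set y | forall z, xi z -> dist2 y x <= dist2 y z].

Definition polytope (R : realType) (d : nat) (C : set 'rV[R]_d) : Prop :=
  ebounded C /\
  exists hs : seq ('rV[R]_d * R),
    C = [set y | forall h, h \in hs -> dotv h.1 y <= h.2].

Definition Npol (R : realType) (d : nat) (xi : set 'rV[R]_d) : Prop :=
  forall x, xi x -> polytope (Vor x xi).

Definition face (R : realType) (d : nat) (C F : set 'rV[R]_d) : Prop :=
  exists (a : 'rV[R]_d) (b : R), a != 0 /\
    (forall y, C y -> dotv a y <= b) /\
    F = C `&` [set y | dotv a y = b].

Definition affdim_ge (R : realType) (d : nat) (F : set 'rV[R]_d) (k : nat) : Prop :=
  exists (v0 : 'rV[R]_d) (V : 'M[R]_(k, d)),
    F v0 /\ (forall i, F (v0 + row i V)) /\ row_free V.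

Definition affdim_eq (R : realType) (d : nat) (F : set 'rV[R]_d) (k : nat) : Prop :=
  affdim_ge F k /\ ~ affdim_ge F k.+1.

Definition DTedge (R : realType) (d : nat) (xi : set 'rV[R]_d) (x y : 'rV[R]_d) : Prop :=
  xi x /\ xi y /\ x <> y /\
  exists F, face (Vor x xi) F /\ face (Vor y xi) F /\ affdim_eq F (d - 1).

(* Edges are indexed by the unordered pair [set x; y].
   W is an i.i.d. Bernoulli(p) family indexed by the edge set of DT(xi). *)
Definition iid_bernoulli_edges (R : realType) (d : nat) (xi : set 'rV[R]_d) (p : R)
    (dO : measure_display) (Omega : measurableType dO) (mu : probability Omega R)
    (W : set 'rV[R]_d -> Omega -> bool) : Prop :=
  (forall x y, DTedge xi x y -> measurable [set w | W [set x; y] w]) /\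
  forall (n : nat) (ex ey : 'I_n -> 'rV[R]_d) (b : 'I_n -> bool),
    (forall i, DTedge xi (ex i) (ey i)) ->
    (forall i j, [set ex i; ey i] = [set ex j; ey j] -> i = j) ->
    mu (\bigcap_(i in [set: 'I_n]) [set w | W [set ex i; ey i] w = b i]) =
    (\prod_(i < n) (if b i then p else 1 - p))%:E.

Definition open_adj (R : realType) (d : nat) (xi : set 'rV[R]_d)
    (Omega : Type) (W : set 'rV[R]_d -> Omega -> bool) (w : Omega) : relation 'rV[R]_d :=
  fun x y => DTedge xi x y /\ W [set x; y] w.

Definition component (R : realType) (d : nat) (xi : set 'rV[R]_d)
    (Omega : Type) (W : set 'rV[R]_d -> Omega -> bool) (w : Omega) (x : 'rV[R]_d) :=
  [set y | clos_refl_trans _ (open_adj xi W w) x y].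

Definition bounded_components (R : realType) (d : nat) (xi : set 'rV[R]_d)
    (Omega : Type) (W : set 'rV[R]_d -> Omega -> bool) (w : Omega) : Prop :=
  forall x, xi x -> ebounded (component xi W w x).

(* Main.v *)
Require Import Defs.
From mathcomp Require Import all_boot all_order all_algebra.
From mathcomp Require Import all_classical all_reals all_analysis.
From mathcomp Require Import archimedean ring lra zify.
From Stdlib Require Import Relations.

Import Order.TTheory GRing.Theory Num.Theory.
Import numFieldTopology.Exports numFieldNormedType.Exports.
Local Open Scope classical_set_scope.
Local Open Scope ring_scope.

Set Implicit Arguments.
Unset Strict Implicit.
Unset Printing Implicit Defensive.

(* Divide space into cubic cells of side K.  An open edge {x, y} joins the cells
   of x and y through a common point z of Vor x and Vor y: every point u of the
   segment [x, z] stays in Vor x, so a nonempty cell containing u is near x.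
   Hence an unbounded component yields a connected infinite set of cells, each
   empty or near an endpoint of an open edge, and from it chains of any length n
   of well separated such cells with bounded jumps; the number of these chains
   is C^n with C independent of K.

   Call a cell good if all cells of a fixed neighbourhood contain between 1 and
   M points.  Near a good cell Delaunay edges are short, so boundedly many edges
   can be open there, and separated good cells involve distinct edges.  A chain
   has either half of its cells not good, or half of them good with an open edge
   nearby.  By independence at distance L <= K the first has probability at most
   eta^n, and for small p so has the second given the points; both beat C^n.
   The probability that a large cell is empty is small by independence of its
   subcells, unless the process is almost surely empty. *)

(** * Chains of lattice cells *)

Section Cells.
Context {d : nat}.
Implicit Types u v w : 'rV[int]_d.

Definition near_cell (m : nat) v w : bool := [forall i, `|v 0 i - w 0 i| <= m%:Z].

Lemma near_cellP m v w : reflect (forall i, `|v 0 i - w 0 i| <= m%:Z) (near_cell m v w).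
Proof. exact: forallP. Qed.

Lemma near_cell_refl m v : near_cell m v v.
Proof. by apply/near_cellP => i; rewrite subrr normr0. Qed.

Lemma near_cell_sym m v w : near_cell m v w = near_cell m w v.
Proof. by apply: eq_forallb => i; rewrite distrC. Qed.

Lemma near_cell_trans m n u v w : near_cell m u v -> near_cell n v w -> near_cell (m + n) u w.
Proof.
move=> /near_cellP uv /near_cellP vw; apply/near_cellP => i.
by rewrite PoszD (le_trans (ler_distD (v 0 i) _ _))// lerD.
Qed.

Lemma near_cell_le m n v w : (m <= n)%N -> near_cell m v w -> near_cell n v w.
Proof. by move=> mn /near_cellP h; apply/near_cellP => i; rewrite (le_trans (h i)). Qed.

Lemma near_cell0 v w : near_cell 0 v w = (v == w).
Proof.
apply/near_cellP/eqP => [h|-> i]; last by rewrite subrr normr0.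
by apply/rowP => i; apply/eqP; rewrite -subr_eq0 -normr_le0.
Qed.

Definition ball_cells (m : nat) v : seq 'rV[int]_d :=
  [seq v + \row_i ((f i : nat)%:Z - m%:Z) | f : {ffun 'I_d -> 'I_(2 * m).+1}].

Lemma ball_cellsP m v w : reflect (exists f : {ffun 'I_d -> 'I_(2 * m).+1},
  w = v + \row_i ((f i : nat)%:Z - m%:Z)) (w \in ball_cells m v).
Proof.
by apply: (iffP mapP) => [[f _ ->]|[f ->]]; exists f; rewrite // mem_enum.
Qed.

Lemma mem_ball_cells m v w : (w \in ball_cells m v) = near_cell m v w.
Proof.
apply/ball_cellsP/near_cellP => [[f ->] i|h].
  rewrite mxE mxE; have := ltn_ord (f i); move: (v 0 i) (nat_of_ord (f i)) => a k ?.
  by lia.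
exists [ffun i : 'I_d => inord `|(w 0 i - v 0 i + m%:Z)%R|%N].
apply/rowP => i; rewrite mxE mxE ffunE; have := h i; move: (v 0 i) (w 0 i) => a b ?.
by rewrite inordK; lia.
Qed.

Lemma size_ball_cells m v : size (ball_cells m v) = ((2 * m).+1 ^ d)%N.
Proof. by rewrite size_image card_ffun !card_ord. Qed.

Definition cell_step (Q : 'rV[int]_d -> Prop) v w := [/\ Q v, Q w & near_cell 1 v w].

(* A path leaving the ball of radius s around a is cut right after its last
   visit to that ball. *)
Lemma last_exit (Q : 'rV[int]_d -> Prop) s a b :
  ~~ near_cell s a b -> clos_refl_trans _ (cell_step Q) a b -> Q b ->
  exists u, [/\ near_cell s.+1 a u, Q u, ~~ near_cell s a u &
    clos_refl_trans _ (cell_step (fun v => Q v /\ ~~ near_cell s a v)) u b].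
Proof.
move=> nab ab Qb.
(* Induction from the end [b] back towards [a]: the left case says that the part of the path after
   [c] has not yet met the ball, the right case that the exit cell is already found. *)
have H c : clos_refl_trans_1n _ (cell_step Q) c b ->
  [/\ Q c, ~~ near_cell s a c &
    clos_refl_trans _ (cell_step (fun v => Q v /\ ~~ near_cell s a v)) c b] \/
  exists u, [/\ near_cell s.+1 a u, Q u, ~~ near_cell s a u &
    clos_refl_trans _ (cell_step (fun v => Q v /\ ~~ near_cell s a v)) u b].
  move=> cb; have : ~~ near_cell s a b /\ Q b by [].
  elim: cb => {c b nab ab Qb} [c [nac Qc]|c c' b [Qc Qc' cc'] _ IH hb].
    by left; split => //; exact: rt_refl.
  have [[_ nac' c'b]|?] := IH hb; last by right.
  have [ac|nac] := boolP (near_cell s a c).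
    right; exists c'; split => //.
    by rewrite -addn1; exact: near_cell_trans cc'.
  left; split => //; apply: rt_trans c'b; apply: rt_step.
  by split.
have [[_]|//] := H a (clos_rt_rt1n _ _ _ _ ab).
by rewrite near_cell_refl.
Qed.

(** [n] counts jumps, so a chain has [n.+1] cells. Jumps are bounded by [s.+1] because a nearest
    neighbour path that leaves a ball of radius [s] lands within [s.+1] of its centre. *)
Fixpoint chains (s n : nat) v : seq (seq 'rV[int]_d) :=
  if n is n'.+1 then
    flatten [seq [seq v :: c | c <- chains s n' u] | u <- ball_cells s.+1 v]
  else [:: [:: v]].

Lemma size_chains s n v : size (chains s n v) = (((2 * s.+1).+1 ^ d) ^ n)%N.
Proof.
elim: n v => //= n IH v; rewrite size_flatten /shape -map_comp.
rewrite (eq_map (g := fun=> (((2 * s.+1).+1 ^ d) ^ n)%N)); last first.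
  by move=> u /=; rewrite size_map IH.
rewrite expnS; set X := (_ ^ n)%N; rewrite -(size_ball_cells _ v); elim: (ball_cells _ _) => //= _ l ->.
by rewrite mulSn.
Qed.

Lemma size_mem_chains s n v c : c \in chains s n v -> size c = n.+1.
Proof.
elim: n v c => /= [v c|n IH v c].
  by rewrite inE => /eqP ->.
by move=> /flatten_mapP[u _] /mapP[c' /IH <- ->].
Qed.

Definition separated s := pairwise (fun v w => ~~ near_cell s v w).

(** Each jump goes to the exit cell [u] given by [last_exit]. The induction hypothesis is applied to
    [Q] strengthened by avoidance of the ball around [a], which separates [a] from all later cells,
    not only from the next one. *)
Lemma exists_chain (Q : 'rV[int]_d -> Prop) s n a b :
  ~~ near_cell (n * s.+1) a b -> clos_refl_trans _ (cell_step Q) a b ->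
  Q a -> Q b ->
  exists c, [/\ c \in chains s n a, separated s c & forall v, v \in c -> Q v].
Proof.
elim: n Q a => [|n IH] Q a nab ab Qa Qb.
  exists [:: a]; split => //; first by rewrite mem_head.
  by move=> v; rewrite inE => /eqP ->.
have nsab : ~~ near_cell s a b.
  by apply: contra nab; apply: near_cell_le; rewrite mulSn; lia.
have [u [au Qu nau ub]] := last_exit nsab ab Qb.
have nub : ~~ near_cell (n * s.+1) u b.
  by apply: contra nab => /(near_cell_trans au); rewrite mulSn.
have [c [cu sc Qc]] := IH _ u nub ub (conj Qu nau) (conj Qb nsab).
exists (a :: c); split.
- apply/flatten_mapP; exists u; first by rewrite mem_ball_cells.
  by apply/mapP; exists c.
- rewrite /separated /= -/(separated s c) sc andbT.
  by apply/allP => v /Qc[].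
- by move=> v; rewrite inE => /predU1P[->//|/Qc[]].
Qed.

End Cells.

(** * Voronoi cells and cubic cells *)

Section Geometry.
Context {R : realType} {d : nat}.
Implicit Types (x y z u : 'rV[R]_d) (xi S : set 'rV[R]_d) (K c : R).

Definition cell_of K x : 'rV[int]_d := \row_i Num.Def.floor (x 0 i / K).

(** A union of half-open cubes of side [K]; [m = 0] gives a single cube of the partition. *)
Definition block K (m : nat) (v : 'rV[int]_d) : set 'rV[R]_d :=
  [set x | near_cell m v (cell_of K x)].

Lemma dist2E x y : dist2 x y = \sum_(i < d) (x 0 i - y 0 i) ^+ 2.
Proof. by apply: eq_bigr => i _; rewrite !mxE expr2. Qed.

Lemma dist2_ge0 x y : 0 <= dist2 x y.
Proof. by rewrite dist2E sumr_ge0// => i _; rewrite sqr_ge0. Qed.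

Lemma coord_dist2 x y i : (x 0 i - y 0 i) ^+ 2 <= dist2 x y.
Proof. by rewrite dist2E (bigD1 i)//= lerDl sumr_ge0// => j _; rewrite sqr_ge0. Qed.

Lemma coord_le_dist2 x y c i : 0 <= c -> dist2 x y <= c ^+ 2 -> `|x 0 i - y 0 i| <= c.
Proof.
move=> c0 h; rewrite -[leRHS]ger0_norm// -ler_sqr ?nnegrE//.
by rewrite !real_normK ?num_real// (le_trans (coord_dist2 _ _ i)).
Qed.

Lemma dist2_le x y c : (forall i, `|x 0 i - y 0 i| <= c) -> dist2 x y <= d%:R * c ^+ 2.
Proof.
move=> h; rewrite dist2E -[d in leRHS]card_ord mulr_natl -sumr_const.
apply: ler_sum => i _; rewrite -[leLHS]real_normK ?num_real//.
by rewrite ler_sqr ?nnegrE// (le_trans (normr_ge0 _) (h i)).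
Qed.

(** Trades the factor sqrt d for the integer [d.+1], so that distances become whole numbers of
    cells. *)
Lemma dim_sqr_le (a : R) : 0 <= a -> d%:R * a ^+ 2 <= (d.+1%:R * a) ^+ 2.
Proof.
move=> a0; rewrite exprMn ler_wpM2r ?sqr_ge0// -natrX ler_nat; lia.
Qed.

Lemma floor_near (a b : R) (m : nat) : `|a - b| <= m%:R ->
  `|Num.Def.floor a - Num.Def.floor b| <= m%:Z.
Proof.
have H (x y : R) : x - y <= m%:R -> Num.Def.floor x - Num.Def.floor y <= m%:Z.
  move=> xy; rewrite -ltzD1 -(ltr_int R) intrB intrD -pmulrn.
  have /andP[x1 x2] := floor_itv x; have /andP[y1 y2] := floor_itv y.
  by move: y2; rewrite intrD; lra.
rewrite !ler_norml => /andP[h1 h2]; rewrite H// andbT.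
by rewrite lerNl opprB H// -opprB lerNl.
Qed.

Lemma floor_far (a b : R) : 2 <= `|Num.Def.floor a - Num.Def.floor b| -> 1 <= `|a - b|.
Proof.
move=> h; rewrite leNgt; apply/negP => /ltW /(@floor_near a b 1).
by move: h; lia.
Qed.

Lemma floor_norm (a b : R) (m : nat) : `|Num.Def.floor a - Num.Def.floor b| <= m%:Z ->
  `|a - b| <= m.+1%:R.
Proof.
rewrite -(ler_int R) -pmulrn intr_norm intrB => h.
have /andP[a1 a2] := floor_itv a; have /andP[b1 b2] := floor_itv b.
move: h a2 b2; rewrite !ler_norml !intrD -natr1 => /andP[h1 h2]; lra.
Qed.

Lemma near_cell_of K x y (m : nat) : 0 < K ->
  (forall i, `|x 0 i - y 0 i| <= m%:R * K) -> near_cell m (cell_of K x) (cell_of K y).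
Proof.
move=> K0 h; apply/near_cellP => i; rewrite !mxE; apply: floor_near.
by rewrite -mulrBl normrM normfV (gtr0_norm K0) ler_pdivrMr.
Qed.

Lemma cell_of_near K x y (m : nat) i : 0 < K ->
  near_cell m (cell_of K x) (cell_of K y) -> `|x 0 i - y 0 i| <= m.+1%:R * K.
Proof.
move=> K0 /near_cellP /(_ i); rewrite !mxE => /floor_norm.
by rewrite -mulrBl normrM normfV (gtr0_norm K0) ler_pdivrMr.
Qed.

Lemma dist2_cell K x y : 0 < K -> cell_of K x = cell_of K y -> dist2 x y <= d%:R * K ^+ 2.
Proof.
move=> K0 xy; apply: dist2_le => i.
by rewrite -[K]mul1r; apply: (@cell_of_near K x y 0) => //; rewrite xy near_cell_refl.
Qed.

(** Some coordinate of [v] and [w] differs by at least [2 * m + 2]; removing [m] on each side leaves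
    cell indices at least 2 apart, hence a full cell of width [K] in between. *)
Lemma block_dist K (m : nat) v w x y : 0 < K -> ~~ near_cell (2 * m).+1 v w ->
  block K m v x -> block K m w y -> K ^+ 2 <= dist2 x y.
Proof.
move=> K0; rewrite /near_cell negb_forall => /existsP[i].
rewrite -ltNge => vwi /near_cellP /(_ i) hx /near_cellP /(_ i) hy.
rewrite (le_trans _ (coord_dist2 _ _ i))// -[leRHS]real_normK ?num_real//.
rewrite ler_sqr ?nnegrE// ?(ltW K0)//.
have : 1 <= `|x 0 i / K - y 0 i / K|.
  apply: floor_far; move: hx hy vwi; rewrite !mxE; clear.
  move: (v 0 i) (w 0 i) (Num.Def.floor _) (Num.Def.floor _) => a b e f; lia.
by rewrite -mulrBl normrM normfV (gtr0_norm K0) ler_pdivlMr// mul1r.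
Qed.

(** Along the segment, the difference of the squared distances to [y] and to [x] is affine in [t],
    and it is nonnegative at both ends. *)
Lemma vor_segment xi x z t : 0 <= t <= 1 -> Vor x xi z -> Vor x xi (x + t *: (z - x)).
Proof.
move=> /andP[t0 t1] zx w /zx.
set u := x + _.
have H (y : 'rV[R]_d) : dist2 u y - dist2 u x =
    t * (dist2 z y - dist2 z x) + (1 - t) * dist2 x y.
  rewrite !dist2E -!sumrB !mulr_sumr -big_split/=; apply: eq_bigr => i _.
  by rewrite !mxE; ring.
rewrite -[in X in _ -> X]subr_ge0 H => h.
by rewrite addr_ge0// mulr_ge0 ?subr_ge0// dist2_ge0.
Qed.

Lemma dist2_segment x z t : dist2 (x + t *: (z - x)) x = t ^+ 2 * dist2 z x.
Proof. by rewrite !dist2E mulr_sumr; apply: eq_bigr => i _; rewrite !mxE; ring. Qed.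

(** A point [y] of [xi] in the cell of [u] would give |u - x| <= |u - y| <= sqrt d K, which places
    [u] within [d.+1] cells of [x]. *)
Lemma vor_far_empty K xi x u : 0 < K -> Vor x xi u ->
  ~~ near_cell d.+1 (cell_of K x) (cell_of K u) -> xi `&` block K 0 (cell_of K u) = set0.
Proof.
move=> K0 ux; apply: contraNP => /eqP/set0P[y [xiy yu]].
rewrite near_cell_sym; apply: near_cell_of => // i; apply: coord_le_dist2.
  by rewrite mulr_ge0// ltW.
apply: (le_trans (ux y xiy)); apply: le_trans (dim_sqr_le (ltW K0)).
apply: dist2_cell => //; apply/eqP.
by move: yu; rewrite /block/= near_cell0.
Qed.

(** If [z] were farther than [c] from [x], the point [u] of the segment at distance exactly [c]
    would lie in the Voronoi cell of [x], while the cube of [u] holds a point of [xi] at distance at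
    most sqrt d K < c. *)
Lemma vor_bounded K xi x z : 0 < K -> Vor x xi z ->
  (forall v, near_cell d.+1 (cell_of K x) v -> xi `&` block K 0 v !=set0) ->
  dist2 z x <= (d.+1%:R * K) ^+ 2.
Proof.
move=> K0 zx h; rewrite leNgt; apply/negP; set c := _ * K => cz.
have c0 : 0 < c by rewrite mulr_gt0.
set D := Num.sqrt (dist2 z x).
have D2 : D ^+ 2 = dist2 z x by rewrite sqr_sqrtr ?dist2_ge0.
have cD : c < D by rewrite -ltr_sqr ?nnegrE ?(ltW c0) ?sqrtr_ge0// D2.
have D0 : 0 < D := lt_trans c0 cD.
have ux : Vor x xi (x + (c / D) *: (z - x)).
  by apply: vor_segment => //; rewrite divr_ge0 ?(ltW c0) ?(ltW D0)//= ler_pdivrMr// mul1r ltW.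
have ud : dist2 (x + (c / D) *: (z - x)) x = c ^+ 2.
  by rewrite dist2_segment -D2 -exprMn divfK ?gt_eqF.
move: ux ud; set u := x + _ => ux ud.
have xu : near_cell d.+1 (cell_of K x) (cell_of K u).
  apply: near_cell_of => // i; rewrite distrC; apply: coord_le_dist2; first exact: ltW.
  by rewrite ud.
have [y [xiy yu]] := h _ xu.
have : c ^+ 2 <= d%:R * K ^+ 2.
  rewrite -ud (le_trans (ux y xiy))//; apply: dist2_cell => //; apply/eqP.
  by move: yu; rewrite /block/= near_cell0.
rewrite leNgt => /negP; apply; rewrite /c exprMn ltr_pM2r ?exprn_gt0//.
by rewrite -natrX ltr_nat; lia.
Qed.

(** The affine dimension of the shared face provides a point of it; membership in both Voronoi cells
    gives the two inequalities between the distances. *)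
Lemma DTedge_vertex xi x y : DTedge xi x y -> exists z,
  [/\ Vor x xi z, Vor y xi z & dist2 z x = dist2 z y].
Proof.
move=> [xix [xiy [_ [F [[a [b [_ [_ FE]]]] [[a' [b' [_ [_ FE']]]] [[z [V [Fz _]]] _]]]]]]].
have zx : Vor x xi z by move: Fz; rewrite FE => -[].
have zy : Vor y xi z by move: Fz; rewrite FE' => -[].
by exists z; split => //; apply/eqP; rewrite eq_le zx//= zy.
Qed.

Lemma DTedge_sym xi x y : DTedge xi x y -> DTedge xi y x.
Proof.
move=> [xix [xiy [xy [F [fx [fy aF]]]]]].
by do !split => //; [exact/nesym|exists F].
Qed.

(** The common point [z] is within [d.+1%:R * K] of [x] by [vor_bounded] and equally far from [y],
    so nonempty cells around [x] alone control both endpoints. *)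
Lemma DTedge_near K xi x y : 0 < K -> DTedge xi x y ->
  (forall v, near_cell d.+1 (cell_of K x) v -> xi `&` block K 0 v !=set0) ->
  near_cell (2 * d.+1) (cell_of K x) (cell_of K y).
Proof.
move=> K0 /DTedge_vertex[z [zx zy e]] h.
have zx2 := vor_bounded K0 zx h; have zy2 := zx2; rewrite e in zy2.
have c0 : 0 <= d.+1%:R * K by rewrite mulr_ge0// ltW.
apply: near_cell_of => // i.
rewrite (le_trans (ler_distD (z 0 i) _ _))// natrM -mulrA -natr1 mulrDl !mul1r lerD//.
  by rewrite distrC; exact: coord_le_dist2.
exact: coord_le_dist2.
Qed.

Lemma vor_path K xi x z (Q : 'rV[int]_d -> Prop) : 0 < K ->
  (forall u, Vor x xi u -> Q (cell_of K u)) -> Vor x xi z ->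
  clos_refl_trans _ (cell_step Q) (cell_of K x) (cell_of K z).
Proof.
move=> K0 hQ zx.
(* The segment is cut into [m] equal steps, with [m] so large that every coordinate moves by at most
   [K] in one step. *)
pose m := (Num.Def.trunc (\sum_(i < d) `|z 0 i - x 0 i| / K)).+1.
have hm i : `|z 0 i - x 0 i| / m%:R <= K.
  rewrite ler_pdivrMr// mulrC -ler_pdivrMr//.
  apply: le_trans (ltW (truncnS_gt _)).
  by rewrite (bigD1 i)//= lerDl sumr_ge0// => j _; rewrite divr_ge0// ltW.
pose u (j : nat) := x + (j%:R / m%:R) *: (z - x).
have uV (j : nat) : (j <= m)%N -> Vor x xi (u j).
  move=> jm; apply: vor_segment => //.
  by rewrite divr_ge0//= ler_pdivrMr// mul1r ler_nat.
have -> : z = u m by rewrite /u divff ?pnatr_eq0// scale1r addrC subrK.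
suff H (j : nat) : (j <= m)%N ->
  clos_refl_trans _ (cell_step Q) (cell_of K x) (cell_of K (u j)) by exact: H.
elim: j => [_|j IH jm].
  by rewrite /u mul0r scale0r addr0; exact: rt_refl.
apply: rt_trans (IH (ltnW jm)) _; apply: rt_step; split.
- exact/hQ/uV/ltnW.
- exact/hQ/uV.
- apply: near_cell_of => // i; rewrite mul1r !mxE.
  apply: le_trans (hm i); rewrite -natr1 [X in `|X|](_ : _ = - ((z 0 i - x 0 i) / m%:R)).
    by rewrite normrN normrM normfV normr_nat.
  by field; rewrite pnatr_eq0.
Qed.

Lemma ebounded_block K m v S : 0 < K -> S `<=` block K m v -> ebounded S.
Proof.
move=> K0 SB; exists (d%:R * (\sum_(i < d) (`|v 0 i|%:~R + m.+1%:R) * K) ^+ 2) => y /SB yB.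
apply: dist2_le => i; rewrite mxE subr0 (bigD1 i)//= -[leLHS]addr0.
have h0 (j : 'I_d) : (0 : R) <= (`|v 0 j|%:~R + m.+1%:R) * K.
  by rewrite mulr_ge0 ?ltW// ltW// addr_ge0// ler0z.
apply: lerD; last by apply: sumr_ge0.
rewrite -ler_pdivrMr//.
have -> : `|y 0 i| / K = `|y 0 i / K| by rewrite normrM normfV (gtr0_norm K0).
move/near_cellP : yB => /(_ i); rewrite mxE.
set a := _ / K; set b := v 0 i => h.
have /andP[a1 a2] := floor_itv a.
have : `|Num.Def.floor a| <= `|b| + m%:Z by lia.
rewrite -(ler_int R) intrD -pmulrn => h'.
have : `|a| <= `|Num.Def.floor a|%:~R + 1.
  rewrite intr_norm; move: a2; rewrite intrD => a2.
  by rewrite ler_norml; apply/andP; split; case: (ger0P ((Num.Def.floor a)%:~R : R)); lra.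
by rewrite -natr1; lra.
Qed.

End Geometry.

(** * Counting events and independence *)

Section SeqSets.
Context {I : eqType} {T : Type}.
Implicit Types (F : I -> set T) (s : seq I).

Lemma bigcup_cons F i s :
  \bigcup_(j in [set` i :: s]) F j = F i `|` \bigcup_(j in [set` s]) F j.
Proof.
apply/seteqP; split=> x.
  move=> [j] /=; rewrite inE => /predU1P[->|js] Fj; first by left.
  by right; exists j.
by move=> [Fi|[j js Fj]]; [exists i => //=|exists j => //=]; rewrite inE ?eqxx// js orbT.
Qed.

Lemma bigcap_cons F i s :
  \bigcap_(j in [set` i :: s]) F j = F i `&` \bigcap_(j in [set` s]) F j.
Proof.
apply/seteqP; split=> x.
  move=> h; split; first by apply: h => /=; rewrite mem_head.
  by move=> j js; apply: h => /=; rewrite inE js orbT.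
by move=> [Fi h] j /=; rewrite inE => /predU1P[->//|/h].
Qed.

End SeqSets.

Lemma measure_bigcup_seq {R : realType} d (T : measurableType d)
    (mu : probability T R) (I : eqType) (F : I -> set T) (s : seq I) (c : R) :
  (forall i, i \in s -> measurable (F i)) -> (forall i, i \in s -> (mu (F i) <= c%:E)%E) ->
  (mu (\bigcup_(i in [set` s]) F i) <= ((size s)%:R * c)%:E)%E.
Proof.
elim: s => [_ _|i s IH mF Fc].
  by rewrite set_nil bigcup_set0 measure0 mul0r.
have ms j : j \in s -> j \in i :: s by rewrite inE orbC => ->.
rewrite bigcup_cons (le_trans (measureU2 _ _ _))//.
- by apply: mF; rewrite mem_head.
- by apply: fin_bigcup_measurable => [|j /ms]; [exact: finite_seq|exact: mF].
- rewrite /= -add1n natrD mulrDl mul1r EFinD leeD//.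
    by apply: Fc; rewrite mem_head.
  by apply: IH => j /ms; [exact: mF|exact: Fc].
Qed.

Section CountEvents.
Context {R : realType} {d : nat}.
Implicit Types (S A : set 'rV[R]_d) (Q : nat -> Prop) (xi : Nspace R d).
Local Notation rV := 'rV[R]_d.

Let borelT := g_sigma_algebraType [set U : set rV | open U].

Lemma borel_half i (c : R) : borel_set [set x : rV | x 0 i < c].
Proof.
apply: sub_sigma_algebra => /=.
have := @open_comp _ _ (fun x : rV => x 0 i) [set a : R | a < c].
apply; last exact: open_lt.
by move=> x _; exact: coord_continuous.
Qed.

(** There are countably many cells, each a finite intersection of differences of open
    half-spaces. *)
Lemma borel_cells (K : R) (Q : 'rV[int]_d -> Prop) : 0 < K ->
  borel_set [set x : rV | Q (cell_of K x)].
Proof.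
move=> K0.
pose H i c : set borelT := [set x : rV | x 0 i < c].
have mH i c : measurable (H i c) by exact: borel_half.
have -> : [set x | Q (cell_of K x)] = \bigcup_v
   if `[< Q v >] then \bigcap_i (H i ((v 0 i + 1)%:~R * K) `\` H i ((v 0 i)%:~R * K)) else set0.
  apply/seteqP; split=> x /=.
    move=> Qx; exists (cell_of K x) => //; case: asboolP => // _ i _.
    split; rewrite /H/= mxE.
      by rewrite -ltr_pdivrMr//; case/andP: (floor_itv (x 0 i / K)).
    apply/negP; rewrite -leNgt -ler_pdivlMr//.
    by case/andP: (floor_itv (x 0 i / K)).
  move=> [v _]; case: asboolP => // Qv h.
  suff -> : cell_of K x = v by [].
  apply/rowP => i; rewrite mxE; apply: floor_def.
  have [/= h1 /negP] := h i I; rewrite /H/= -leNgt => h2.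
  by rewrite ler_pdivlMr// ltr_pdivrMr// h1 h2.
suff : measurable (\bigcup_v if `[< Q v >] then \bigcap_i
   (H i ((v 0 i + 1)%:~R * K) `\` H i ((v 0 i)%:~R * K)) else set0) by [].
apply: countable_bigcupT_measurable; first exact: countableP.
move=> v; case: asboolP => // _.
by apply: fin_bigcap_measurable; [exact: finite_finset|move=> i _; exact: measurableD].
Qed.

Lemma borel_block (K : R) m v : 0 < K -> borel_set (block K m v : set rV).
Proof. exact: (borel_cells (fun c => near_cell m v c)). Qed.

(** Infinitely many points in [S] satisfy no [Q], so the event is a countable union of generators of
    the sigma-algebra. *)
Definition count_event S Q : set (Nspace R d) :=
  [set xi | exists n, Q n /\ (pts xi `&` S #= `I_n)%card].

Lemma measurable_count_event S Q : borel_set S -> measurable (count_event S Q).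
Proof.
move=> bS; have -> : count_event S Q = \bigcup_(n in Q) count_event S (eq n).
  apply/seteqP; split=> xi.
    by move=> [n [Qn h]]; exists n => //; exists n.
  by move=> [n Qn [_ [<- h]]]; exists n.
apply: bigcup_measurable => n _; apply: sub_sigma_algebra; exists S, n.
split => //; apply/seteqP; split=> xi; first by move=> [_ [<-]].
by move=> h; exists n.
Qed.

Lemma count_event_restrict S A Q xi : S `<=` A ->
  count_event S Q (Defs.restrict A xi) = count_event S Q xi.
Proof. by move=> SA; rewrite /count_event /= -setIA (setIidr SA). Qed.

Lemma empty_count_event S xi : count_event S (eq 0%N) xi <-> pts xi `&` S = set0.
Proof.
split=> [[n [<-]]|h].
  by rewrite II0 card_eq0 => /eqP.
by exists 0%N; split=> //; rewrite II0 h.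
Qed.

Lemma locally_finite_translate (x : rV) S : locally_finite S -> locally_finite (translate x S).
Proof.
move=> lS B [r Br].
apply: (@sub_finite_set _ _ ((fun y => y - x) @` (S `&` [set y | B (y - x)]))).
  by move=> _ [[y Sy <-] By]; exists y.
apply: finite_image; apply: lS.
(* From |y|^2 <= 2 |y - x|^2 + 2 |x|^2, where the gap is |y - 2x|^2. *)
exists (2 * r + 2 * dist2 x 0) => y /Br; rewrite !dist2E => h.
apply: (@le_trans _ _ (2 * \sum_i ((y - x) 0 i - (0 : rV) 0 i) ^+ 2 + 2 * \sum_i (x 0 i - (0 : rV) 0 i) ^+ 2)).
  rewrite !mulr_sumr -big_split/=; apply: ler_sum => i _; rewrite !mxE.
  rewrite -subr_ge0.
  have -> : 2 * (y 0 i - x 0 i - 0) ^+ 2 + 2 * (x 0 i - 0) ^+ 2 - (y 0 i - 0) ^+ 2 =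
    (y 0 i - 2 * x 0 i) ^+ 2 by ring.
  exact: sqr_ge0.
by rewrite lerD2r ler_pM2l.
Qed.

(** Puts the image event of [stationary] in a usable form: translations are injective, so they
    preserve counts, and a preimage of [eta] is obtained by translating back by [- x]. *)
Lemma translate_count_event (x : rV) S Q :
  [set eta : Nspace R d | exists2 xi : Nspace R d, count_event S Q xi &
     pts eta = translate x (pts xi)] = count_event (translate x S) Q.
Proof.
have H (A : set rV) n : (translate x A `&` translate x S #= `I_n)%card = (A `&` S #= `I_n)%card.
  have -> : translate x A `&` translate x S = (fun y => y - x) @` (A `&` S).
    apply/seteqP; split=> [_ [[y Ay <-] [z Sz /addIr zy]]|_ [y [Ay Sy] <-]].
      by exists y => //; split => //; rewrite -zy.
    by split; exists y.
  have e := @inj_card_eq _ _ (A `&` S) (fun y => y - x) (in2W (@addIr _ (- x))).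
  by apply/idP/idP; apply: card_eq_trans => //; rewrite card_eq_sym.
apply/seteqP; split=> eta.
  by move=> [xi [n [Qn h]] e]; exists n; split => //; rewrite e H.
move=> [n [Qn h]].
have e : pts eta = translate x (translate (- x) (pts eta)).
  apply/seteqP; split=> y.
    move=> ey; exists (y + x); last by rewrite addrK.
    by exists y => //; rewrite opprK.
  by move=> [_ [z ez <-] <-]; rewrite opprK addrK.
exists (LFSet (locally_finite_translate (- x) (pts_lf eta))) => //.
by exists n; split => //; rewrite -H -e.
Qed.

Lemma translate_block (K : R) (v : 'rV[int]_d) : 0 < K ->
  translate (- (\row_i ((v 0 i)%:~R * K))) (block K 0 0) = block K 0 v.
Proof.
move=> K0; set c := \row_i _.
have cell_c y : cell_of K (y + c) = cell_of K y + v.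
  apply/rowP => i; rewrite !mxE mulrDl mulfK ?gt_eqF// floorDrz ?intrKfloor//.
rewrite /block; apply/seteqP; split=> [_ [y /= h <-]|y /= h].
  by rewrite opprK cell_c; move: h; rewrite !near_cell0 => /eqP <-; rewrite add0r.
exists (y - c); last by rewrite opprK subrK.
move: h; rewrite /= !near_cell0 -{1}(subrK c y) cell_c => /eqP h.
by apply/eqP/(@addIr _ v); rewrite add0r.
Qed.

Lemma count_event_stationary (P : probability (Nspace R d) R) (K : R) v Q :
  stationary P -> 0 < K -> P (count_event (block K 0 v) Q) = P (count_event (block K 0 0) Q).
Proof.
move=> stP K0; rewrite -translate_block// -translate_count_event; apply: stP.
by apply: measurable_count_event; exact: borel_block.
Qed.

End CountEvents.

(** The body of [finite_range_dependence] at a fixed range [L], to be compared with the scale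
    [K]. *)
Definition independent_beyond {R : realType} {d : nat}
    (P : probability (Nspace R d) R) (L : R) : Prop :=
  forall A B : set 'rV[R]_d, borel_set A -> borel_set B ->
    (forall a b, A a -> B b -> L ^+ 2 <= dist2 a b) ->
    forall E1 E2 : set (Nspace R d), measurable E1 -> measurable E2 ->
      P (Defs.restrict A @^-1` E1 `&` Defs.restrict B @^-1` E2) =
      (P (Defs.restrict A @^-1` E1) * P (Defs.restrict B @^-1` E2))%E.

Section Independence.
Context {R : realType} {d : nat} (P : probability (Nspace R d) R).

(** Induction on [J]: the block of [v] and the union [B] of the remaining blocks are at distance at
    least [K], hence [L], and by [locE] the two events depend only on the points inside these
    sets. *)
Lemma separated_events_le (L K delta : R) (m : nat)
    (E : 'rV[int]_d -> set (Nspace R d)) (J : seq 'rV[int]_d) :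
  independent_beyond P L -> 0 < L -> L <= K -> (forall v, measurable (E v)) ->
  (forall v, (P (E v) <= delta%:E)%E) ->
  (forall v A xi, block K m v `<=` A -> E v (Defs.restrict A xi) = E v xi) ->
  separated (2 * m).+1 J ->
  (P (\bigcap_(v in [set` J]) E v) <= (delta ^+ size J)%:E)%E.
Proof.
move=> indep L0 LK mE Ed locE.
have K0 : 0 < K := lt_le_trans L0 LK.
elim: J => [_|v J IH].
  by rewrite set_nil bigcap_set0 expr0 probability_le1.
rewrite /separated /= => /andP[/allP vJ /IH{}IH].
pose B : set 'rV[R]_d := [set x | has (fun w => near_cell m w (cell_of K x)) J].
have eA : E v = Defs.restrict (block K m v) @^-1` E v.
  by apply/seteqP; split=> xi; rewrite /= locE.
have eB : \bigcap_(w in [set` J]) E w = Defs.restrict B @^-1` (\bigcap_(w in [set` J]) E w).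
  by apply/seteqP; split=> xi h w wJ; have := h w wJ; rewrite /preimage/= locE//;
    move=> x xw; apply/hasP; exists w.
rewrite bigcap_cons {1}eA {1}eB indep -?eA -?eB.
- by rewrite exprS EFinM; apply: lee_pmul.
- exact: borel_block.
- exact: (borel_cells (fun c => has (fun w => near_cell m w c) J)).
- move=> a b va /hasP[w wJ wb]; rewrite (@le_trans _ _ (K ^+ 2))//.
    by rewrite ler_sqr ?nnegrE ?(ltW L0) ?(ltW K0).
  exact: (block_dist K0 (vJ w wJ) va wb).
- exact: mE.
- by apply: fin_bigcap_measurable => [|w _]; [exact: finite_seq|exact: mE].
Qed.

End Independence.

(** * Choice of the scale *)

Lemma ae_countable d (T : measurableType d) (R : realType) (mu : probability T R)
    (I : countType) (Q : I -> T -> Prop) :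
  (forall i, {ae mu, forall x, Q i x}) -> {ae mu, forall x, forall i, Q i x}.
Proof.
move=> h; have : {ae mu, forall x, forall n, if unpickle n is Some i then Q i x else True}.
  apply: ae_foralln => n; case: unpickle => [i|]; [exact: h|exact: aeW].
by apply: filterS => x hx i; have := hx (pickle i); rewrite pickleK.
Qed.

Section Scales.
Context {R : realType} {d : nat} (P : probability (Nspace R d) R).
Local Notation emp K v := (@count_event R d (block K 0 v) (eq 0%N)).
Local Notation bad M K v :=
  (@count_event R d (block K 0 v) (fun n : nat => n = 0%N \/ (M < n)%N)).

Lemma block_sub_scale (K : R) (n : nat) (w : 'rV[int]_d) : 0 < K ->
  (forall i, 0 <= w 0 i < n%:Z) -> block K 0 w `<=` block (n%:R * K) 0 0.
Proof.
move=> K0 hw x; rewrite /block/= !near_cell0 => /eqP wx.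
rewrite eq_sym; apply/eqP/rowP => i; rewrite !mxE; apply: floor_def.
have /andP[w0 wn] := hw i; move: w0 wn; rewrite wx mxE => w0 wn.
have n0 : 0 < n%:R :> R by rewrite ltr0n; lia.
have /andP[f1 f2] := floor_itv (x 0 i / K).
rewrite invfM mulrCA mulrC; apply/andP; split.
  by rewrite divr_ge0 ?(ltW n0)// (le_trans _ f1)// ler0z.
rewrite ltr_pdivrMr// add0r mul1r (lt_le_trans f2)// -[n%:R]/(n%:Z%:~R) ler_int.
by rewrite lezD1.
Qed.

Lemma emp_sub (K K' : R) v w : block K 0 v `<=` block K' 0 w -> emp K' w `<=` emp K v.
Proof.
move=> sub xi /empty_count_event h; apply/empty_count_event.
by apply/seteqP; split=> // x [xx /sub xs]; rewrite -h.
Qed.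

Lemma finite_pts_block (xi : Nspace R d) (K : R) (m : nat) v : 0 < K ->
  finite_set (pts xi `&` block K m v).
Proof. by move=> K0; apply: pts_lf; exact: (ebounded_block K0 (@subset_refl _ _)). Qed.

(** The count [n] is finite; choosing the cap [M] equal to it rules out [M < n] and leaves
    [n = 0]. *)
Lemma bad_cap (K : R) v : \bigcap_M bad M K v `<=` emp K v.
Proof.
move=> xi h; have [n [_ hn]] := h 0%N I.
have [n' [n'n hn']] := h n I.
have e : n' = n.
  by move: hn'; rewrite card_eq_sym => /card_eq_trans /(_ hn) /card_eq_II.
exists n; split => //; move: n'n; rewrite e ltnn => -[->//|//].
Qed.

(** Continuity from above: the events [bad M K v] decrease in [M] to the event that the cell is
    empty. *)
Lemma exists_cap (K eta : R) v : 0 < K -> (P (emp K v) < eta%:E)%E ->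
  exists M, (P (bad M K v) < eta%:E)%E.
Proof.
move=> K0 h; apply: contrapT => /forallNP hM.
have mbad M : measurable (bad M K v) by apply: measurable_count_event; exact: borel_block.
have memp : measurable (emp K v) by apply: measurable_count_event; exact: borel_block.
have bM : \bigcap_M bad M K v = emp K v.
  apply/seteqP; split; first exact: bad_cap.
  by move=> xi [n [<- hn]] M _; exists 0%N; split => //; left.
have c : (P \o (fun M => bad M K v)) x @[x --> \oo] --> P (\bigcap_M bad M K v).
  apply: nonincreasing_cvg_mu => //.
  - by rewrite (le_lt_trans (probability_le1 _ _))// ltry.
  - by rewrite bM.
  - move=> m n mn; apply/subsetPset => xi [k [hk e]]; exists k; split => //.
    by case: hk => [->|nk]; [left|right; exact: leq_ltn_trans nk].
move: h; rewrite ltNge => /negP; apply; rewrite -bM -(cvg_lim _ c)//.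
apply: lime_ge; first by apply/cvg_ex; exists (P (\bigcap_M bad M K v)).
by apply: nearW => M /=; rewrite leNgt; apply/negP; exact: hM.
Qed.

Hypothesis statP : stationary P.

Lemma exists_scale (L eta : R) : (0 < d)%N -> 0 < L ->
  independent_beyond P L ->
  0 < eta -> (P (emp 1 0) < 1)%E ->
  exists K M, [/\ 0 < K, L <= K & forall v, (P (bad M K v) <= eta%:E)%E].
Proof.
move=> d0 L0 indep eta0 q1.
have memp K v : 0 < K -> measurable (emp K v).
  by move=> K0; apply: measurable_count_event; exact: borel_block.
have mono K K' v w : 0 < K -> 0 < K' -> block K 0 v `<=` block K' 0 w ->
    (P (emp K' w) <= P (emp K v))%E.
  by move=> K0 K'0 /emp_sub sub; apply: le_measure; rewrite ?inE //; exact: memp.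
(* An integer side above [L] makes the unit cube a subcube, so a [K0]-cell is empty with probability
   [delta < 1] too. *)
pose n0 := (Num.Def.trunc L).+1; pose K0 : R := n0%:R.
have K00 : 0 < K0 by rewrite ltr0n.
have LK0 : L <= K0 by rewrite ltW// truncnS_gt.
pose delta := fine (P (emp K0 0)).
have dE : P (emp K0 0) = delta%:E.
  by rewrite fineK// fin_num_measure//; exact: memp.
have delta0 : 0 <= delta by rewrite fine_ge0.
have delta1 : delta < 1.
  rewrite -lte_fin -dE (le_lt_trans _ q1)//; apply: mono => //.
  rewrite /K0 -[n0%:R]mulr1; apply: block_sub_scale => // i; rewrite mxE.
  by rewrite lexx.
have [n hn] : exists n, delta ^+ n < eta.
  have : delta ^+ k @[k --> \oo] --> (0 : R) by apply: cvg_expr; rewrite ger0_norm.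
  move=> /cvgrPdist_lt /(_ eta eta0)[n _ /(_ n (leqnn n))].
  rewrite sub0r normrN ger0_norm ?exprn_ge0// => hn; by exists n.
(* Every second cell of the diagonal: [n] pairwise separated cells, all inside the cube of
   [N = 2n + 1] cells per side, so that cube is empty with probability at most [delta ^+ n]. *)
pose w (j : nat) : 'rV[int]_d := \row_i (2 * j)%:Z.
pose J := [seq w j | j <- iota 0 n].
pose N := (2 * n).+1.
have K1 : 0 < N%:R * K0 by rewrite mulr_gt0// ltr0n.
have emp_small : (P (emp (N%:R * K0) 0) < eta%:E)%E.
  apply: (@le_lt_trans _ _ (P (\bigcap_(v in [set` J]) emp K0 v))).
    apply: le_measure; rewrite ?inE; first exact: memp.
      by apply: fin_bigcap_measurable => [|v _]; [exact: finite_seq|exact: memp].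
    move=> xi h v /= /mapP[j]; rewrite mem_iota add0n => jn ->.
    apply: emp_sub h; apply: block_sub_scale => // i; rewrite mxE /N; lia.
  rewrite (@le_lt_trans _ _ (delta ^+ n)%:E) ?lte_fin//.
  have -> : n = size J by rewrite size_map size_iota.
  apply: (@separated_events_le _ _ P L K0 delta 0) => //.
  - by move=> v; exact: memp.
  - by move=> v; rewrite count_event_stationary// dE.
  - by move=> v A xi; exact: count_event_restrict.
  rewrite /separated pairwise_map.
  have := iota_uniq 0 n; rewrite uniq_pairwise; apply: sub_pairwise => j k /= jk.
  apply/negP => /near_cellP /(_ (Ordinal d0)); rewrite !mxE.
  by move: jk => /eqP; lia.
have [M hM] := exists_cap K1 emp_small.
exists (N%:R * K0), M; split=> //.
  by rewrite (le_trans LK0)// ler_peMl ?(ltW K00)// ler1n.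
by move=> v; rewrite count_event_stationary// ltW.
Qed.

(** By stationarity each of the countably many unit cells is almost surely empty, and these cells
    cover space. *)
Lemma ae_empty : P (emp 1 0) = 1%E -> {ae P, forall xi : Nspace R d, pts xi = set0}.
Proof.
move=> P1; have mE v : measurable (emp 1 v).
  by apply: measurable_count_event; exact: borel_block.
have : {ae P, forall xi, forall v, (emp 1 v) xi}.
  apply: ae_countable => v; exists (~` emp 1 v); split => //; first exact: measurableC.
  by rewrite probability_setC// count_event_stationary// P1 subee.
apply: filterS => xi h; apply/seteqP; split=> // x xix.
have /empty_count_event <- := h (cell_of 1 x).
by split; rewrite // /block/= near_cell_refl.
Qed.

End Scales.

(** * Open edges near good cells *)

Section OpenEdges.
Context {R : realType} {d : nat} (xi : Nspace R d) (K : R) (M : nat).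
Hypothesis K0 : 0 < K.
Local Notation rV := 'rV[R]_d.
Local Notation bad v :=
  (@count_event R d (block K 0 v) (fun n : nat => n = 0%N \/ (M < n)%N) xi).

Definition good_cell (m : nat) v : Prop := forall v', near_cell m v v' -> ~ bad v'.

Lemma not_bad_nonempty v : ~ bad v -> pts xi `&` block K 0 v !=set0.
Proof.
move=> h; apply/set0P/negP => /eqP e; apply: h.
exists 0%N; split; first by left.
by rewrite e II0.
Qed.

Lemma not_bad_points v : ~ bad v -> exists2 l : seq rV, (size l <= M)%N &
  forall x, pts xi x -> block K 0 v x -> x \in l.
Proof.
move=> h; have /finite_setP[n hn] := @finite_pts_block _ _ xi K 0 v K0.
have nM : (n <= M)%N.
  by rewrite leqNgt; apply/negP => Mn; apply: h; exists n; split => //; right.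
move: hn; rewrite card_eq_sym => /card_set_bijP[f [_ _ fS]].
exists [seq f i | i <- iota 0 n]; first by rewrite size_map size_iota.
move=> x xx xv; have [i /= ni <-] := fS x (conj xx xv).
by apply/mapP; exists i => //; rewrite mem_iota.
Qed.

Lemma good_points m v : good_cell m v ->
  exists2 l : seq rV, (size l <= (2 * m).+1 ^ d * M)%N &
    forall x, pts xi x -> block K m v x -> x \in l.
Proof.
move=> gv; rewrite -(size_ball_cells m v).
suff H s : (forall u, u \in s -> ~ bad u) -> exists2 l : seq rV, (size l <= size s * M)%N &
    forall x, pts xi x -> cell_of K x \in s -> x \in l.
  have [|l sl hl] := H (ball_cells m v).
    by move=> u; rewrite mem_ball_cells; exact: gv.
  by exists l => // x xx xv; apply: hl => //; rewrite mem_ball_cells.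
elim: s => [_|u s IH hs]; first by exists [::].
have [|l sl hl] := IH; first by move=> v' v's; apply: hs; rewrite inE v's orbT.
have [l' sl' hl'] := not_bad_points (hs u (mem_head _ _)).
exists (l' ++ l); first by rewrite size_cat mulSn leq_add.
move=> x xx; rewrite inE mem_cat => /predU1P[xu|/hl ->//]; last by rewrite orbT.
by rewrite hl'// /block/= xu near_cell_refl.
Qed.

(** Edges are ordered pairs here, so each one occurs in both orientations; this is harmless for
    union bounds. *)
Definition edge_in m v (e : rV * rV) : Prop :=
  [/\ DTedge (pts xi) e.1 e.2, block K m v e.1 & block K m v e.2].

Lemma good_edges m v : good_cell m v ->
  exists2 l : seq (rV * rV), (size l <= ((2 * m).+1 ^ d * M) ^ 2)%N &
    forall e, e \in l <-> edge_in m v e.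
Proof.
move=> /good_points[l sl hl].
exists [seq e <- [seq (x, y) | x <- l, y <- l] | `[< edge_in m v e >]].
  rewrite size_filter (leq_trans (count_size _ _))// size_allpairs.
  by rewrite -mulnn leq_mul.
move=> e; rewrite mem_filter; split; first by case/andP => /asboolP.
move=> h; apply/andP; split; first exact/asboolP.
case: h => -[ex [ey _]] e1 e2; apply/allpairsP; exists e.
by split; [exact: hl|exact: hl|case: (e)].
Qed.

(** Equal edges would share an endpoint lying in both blocks, which puts [v] and [v'] within [2 * m]
    of each other. *)
Lemma edge_in_disjoint m v v' e e' : ~~ near_cell (2 * m).+1 v v' ->
  edge_in m v e -> edge_in m v' e' -> [set e.1; e.2] <> [set e'.1; e'.2].
Proof.
move=> nvv' [_ v1 _] [_ v'1 v'2] E; move/negP: nvv'; apply.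
have : [set e'.1; e'.2] e.1 by rewrite -E; left.
have H x : block K m v' x -> e.1 = x -> near_cell (2 * m).+1 v v'.
  rewrite /block/= => xv' ex; apply: (@near_cell_le _ (m + m)); first lia.
  apply: (near_cell_trans v1); rewrite near_cell_sym ex; exact: xv'.
by case=> ex; [exact: H v'1 ex|exact: H v'2 ex].
Qed.

Context {dO : measure_display} {Omega : measurableType dO}
  (mu : probability Omega R) (p : R) (W : set rV -> Omega -> bool).
Hypothesis iidW : iid_bernoulli_edges (pts xi) p mu W.
Hypothesis p0 : 0 <= p.

Definition open_edge (e : rV * rV) : set Omega := [set w | W [set e.1; e.2] w].

Definition open_in m v : set Omega := [set w | exists2 e, edge_in m v e & open_edge e w].

Lemma open_inE m v (l : seq (rV * rV)) : (forall e, e \in l <-> edge_in m v e) ->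
  open_in m v = \bigcup_(e in [set` l]) open_edge e.
Proof. by move=> hl; apply/seteqP; split=> w [e /hl h1 h2]; exists e. Qed.

Lemma measurable_open_edge m v e : edge_in m v e -> measurable (open_edge e).
Proof. by move=> [h _ _]; apply: iidW.1. Qed.

Lemma measurable_open_in m v : good_cell m v -> measurable (open_in m v).
Proof.
move=> /good_edges[l _ hl]; rewrite (open_inE hl).
apply: fin_bigcup_measurable; first exact: finite_seq.
by move=> e /hl; exact: measurable_open_edge.
Qed.

(* Induction on J: s records the edges already chosen, with their cells. *)
Lemma open_in_le_aux m (s : seq ('rV[int]_d * (rV * rV))) (J : seq 'rV[int]_d) :
  separated (2 * m).+1 ([seq a.1 | a <- s] ++ J) ->
  (forall a, a \in s -> edge_in m a.1 a.2) -> (forall v, v \in J -> good_cell m v) ->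
  (mu (\bigcap_(a in [set` s]) open_edge a.2 `&` \bigcap_(v in [set` J]) open_in m v) <=
    (p ^+ size s * ((((2 * m).+1 ^ d * M) ^ 2)%:R * p) ^+ size J)%:E)%E.
Proof.
elim: J s => [|v J IH] s.
  rewrite cats0 => sep hs _; rewrite set_nil bigcap_set0 setIT expr0 mulr1.
  pose t (i : 'I_(size s)) := tnth (in_tuple s) i.
  have -> : \bigcap_(a in [set` s]) open_edge a.2 =
      \bigcap_(i in [set: 'I_(size s)]) [set w | W [set (t i).2.1; (t i).2.2] w = true].
    apply/seteqP; split=> w h; first by move=> i _; apply: h; exact: mem_tnth.
    by move=> a /= /(tnthP (in_tuple s))[i ->]; exact: (h i).
  have := iidW.2 (size s) (fun i => (t i).2.1) (fun i => (t i).2.2) (fun=> true).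
  rewrite /= prodr_const card_ord => -> //.
    by move=> i; have [] := hs _ (mem_tnth i (in_tuple s)).
  (* Separation of the cells makes the recorded edges distinct as unordered pairs, as the product
     formula requires. *)
  have lt_neq (i j : 'I_(size s)) : (i < j)%N ->
      [set (t i).2.1; (t i).2.2] <> [set (t j).2.1; (t j).2.2].
    move=> ij; apply: (@edge_in_disjoint m (t i).1 (t j).1); try exact/hs/mem_tnth.
    move: sep; rewrite /separated pairwise_map => /(pairwiseP (t i)) sep.
    by rewrite /t !(tnth_nth (t i)); apply: sep => //; rewrite inE ltn_ord.
  move=> i j e; apply/eqP; apply: contraT; rewrite neq_ltn => /orP[] /lt_neq; first by rewrite e.
  by move=> /nesym; rewrite e.
move=> sep hs hJ; have gv : good_cell m v by apply: hJ; rewrite mem_head.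
have [l sl hl] := good_edges gv.
have {}hJ u : u \in J -> good_cell m u by move=> uJ; apply: hJ; rewrite inE uJ orbT.
(* The event at [v] is split according to which of the finitely many edges near [v] is open; that
   edge joins the record [s]. *)
have -> : \bigcap_(a in [set` s]) open_edge a.2 `&`
    \bigcap_(u in [set` v :: J]) open_in m u = \bigcup_(e in [set` l])
    (\bigcap_(a in [set` rcons s (v, e)]) open_edge a.2 `&`
     \bigcap_(u in [set` J]) open_in m u).
  rewrite bigcap_cons (open_inE hl); apply/seteqP; split=> w.
    move=> [h1 [[e el h2] h3]]; exists e => //; split => // a /=.
    by rewrite mem_rcons inE => /predU1P[->//|/h1].
  move=> [e el [h1 h2]]; split; first by move=> a /= sa; apply: h1; rewrite /= mem_rcons inE sa orbT.
  split => //; exists e => //; apply: (h1 (v, e)).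
  by rewrite /= mem_rcons mem_head.
set c := p ^+ (size s).+1 * ((((2 * m).+1 ^ d * M) ^ 2)%:R * p) ^+ size J.
have hrc e a : e \in l -> a \in rcons s (v, e) -> edge_in m a.1 a.2.
  by move=> /hl ev; rewrite mem_rcons inE => /predU1P[->//|/hs].
have c0 : 0 <= c by rewrite mulr_ge0 ?exprn_ge0// mulr_ge0.
apply: (@le_trans _ _ ((size l)%:R * c)%:E).
  apply: measure_bigcup_seq => e el.
    apply: measurableI; apply: fin_bigcap_measurable; try exact: finite_seq.
      by move=> a /(hrc _ _ el); exact: measurable_open_edge.
    by move=> u /hJ; exact: measurable_open_in.
  rewrite /c -(size_rcons s (v, e)); apply: IH => //; first by rewrite map_rcons cat_rcons.
  by move=> a; exact: hrc.
rewrite lee_fin (@le_trans _ _ ((((2 * m).+1 ^ d * M) ^ 2)%:R * c))//.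
  by rewrite ler_wpM2r// ler_nat.
by rewrite /c !exprS le_eqVlt; apply/orP; left; apply/eqP; ring.
Qed.

Lemma open_in_le m (J : seq 'rV[int]_d) :
  separated (2 * m).+1 J -> (forall v, v \in J -> good_cell m v) ->
  (mu (\bigcap_(v in [set` J]) open_in m v) <=
    (((((2 * m).+1 ^ d * M) ^ 2)%:R * p) ^+ size J)%:E)%E.
Proof.
move=> sJ gJ; have := @open_in_le_aux m [::] J sJ.
by rewrite set_nil bigcap_set0 setTI mul1r; apply.
Qed.

End OpenEdges.

(** * Unbounded components *)

Section BadCells.
Context {R : realType} {d : nat} (xi : Nspace R d) (K : R) (M : nat).
Hypothesis K0 : 0 < K.
Local Notation rV := 'rV[R]_d.
Context {Omega : Type} (W : set rV -> Omega -> bool) (w : Omega).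

Definition blocked v : Prop := pts xi `&` block K 0 v = set0 \/
  exists x y, near_cell d.+1 v (cell_of K x) /\ open_adj (pts xi) W w x y.

Lemma cell_step_sym (Q : 'rV[int]_d -> Prop) a b :
  clos_refl_trans _ (cell_step Q) a b -> clos_refl_trans _ (cell_step Q) b a.
Proof.
elim=> [u v [Qu Qv uv]|u|u v t _ h1 _ h2].
- by apply: rt_step; split; rewrite // near_cell_sym.
- exact: rt_refl.
- exact: rt_trans h2 h1.
Qed.

Lemma cell_step_ends (Q : 'rV[int]_d -> Prop) m a b : ~~ near_cell m a b ->
  clos_refl_trans _ (cell_step Q) a b -> Q a /\ Q b.
Proof.
move=> nab ab; have H a' b' : ~~ near_cell m a' b' ->
    clos_refl_trans _ (cell_step Q) a' b' -> Q a'.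
  move=> na p; case: (clos_rt_rt1n _ _ _ _ p) na => [|c c' [Qa _ _] _ _] //.
  by rewrite near_cell_refl.
by split; [exact: H nab ab|apply: H (cell_step_sym ab); rewrite near_cell_sym].
Qed.

Lemma open_adj_sym x y : open_adj (pts xi) W w x y -> open_adj (pts xi) W w y x.
Proof. by move=> [xy Wxy]; split; [exact: DTedge_sym|rewrite setUC]. Qed.

Lemma vor_blocked x y u : open_adj (pts xi) W w x y -> Vor x (pts xi) u ->
  blocked (cell_of K u).
Proof.
move=> xy ux; have [xu|xu] := boolP (near_cell d.+1 (cell_of K x) (cell_of K u)).
  by right; exists x, y; rewrite near_cell_sym.
by left; exact: vor_far_empty ux xu.
Qed.

Lemma component_path x y : component (pts xi) W w x y ->
  clos_refl_trans _ (cell_step blocked) (cell_of K x) (cell_of K y).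
Proof.
elim=> {x y} [x y xy|x|x y z _ h1 _ h2]; [|exact: rt_refl|exact: rt_trans h1 h2].
have [z [zx zy _]] := DTedge_vertex xy.1.
apply: (rt_trans _ _ _ (cell_of K z)).
  by apply: vor_path zx => // u; exact: vor_blocked xy.
apply: cell_step_sym; apply: vor_path zy => // u.
exact: vor_blocked (open_adj_sym xy).
Qed.

(** An unbounded component is not contained in the block of radius [n * s.+1], so its blocked path
    reaches a cell far enough for [exists_chain]. *)
Lemma unbounded_chain s n x : ~ ebounded (component (pts xi) W w x) ->
  exists c, [/\ c \in chains s n (cell_of K x), separated s c &
    forall v, v \in c -> blocked v].
Proof.
move=> unb; have [y [xy nxy]] : exists y, component (pts xi) W w x y /\
    ~~ near_cell (n * s.+1) (cell_of K x) (cell_of K y).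
  apply: contrapT => /forallNP h; apply: unb.
  apply: (@ebounded_block _ _ K (n * s.+1) (cell_of K x)) => // y xy.
  by apply: contrapT => /negP nxy; exact: (h y).
have p := component_path xy; have [Qx Qy] := cell_step_ends nxy p.
exact: exists_chain nxy p Qx Qy.
Qed.

(** A good cell is nonempty, so it is blocked by an open edge with [x] within [d.+1]; [DTedge_near]
    puts [y] within a further [2 * d.+1], whence the radius [3 * d.+1]. *)
Lemma blocked_open v : good_cell xi K M (3 * d.+1) v -> blocked v ->
  exists2 e, edge_in xi K (3 * d.+1) v e & W [set e.1; e.2] w.
Proof.
move=> gv [e|[x [y [vx [xy Wxy]]]]].
  by have /set0P/eqP := not_bad_nonempty (gv v (near_cell_refl _ _)).
exists (x, y) => //; split => //=; first by apply: near_cell_le vx; lia.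
have xy' : near_cell (2 * d.+1) (cell_of K x) (cell_of K y).
  apply: (DTedge_near K0 xy) => v' xv'; apply: (@not_bad_nonempty _ _ xi K M).
  by apply: gv; apply: near_cell_le (near_cell_trans vx xv'); lia.
by apply: near_cell_le (near_cell_trans vx xy'); lia.
Qed.

End BadCells.

(** The intersection of all [A n] has measure at most that of each [A k]. The bound is asked only
    for arbitrarily large [k], since for fixed points it will be known only at lengths that are not
    [half_bad]. *)
Lemma negligible_geometric {R : realType} d (T : measurableType d)
    (mu : probability T R) (A : nat -> set T) :
  (forall n, measurable (A n)) ->
  (forall n, exists2 k, (n <= k)%N & (mu (A k) <= (2^-1 ^+ k)%:E)%E) ->
  {ae mu, forall x, exists n, ~ A n x}.
Proof.
move=> mA h; exists (\bigcap_n A n).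
have mI : measurable (\bigcap_n A n) by exact: bigcapT_measurable.
split=> //; last first.
  by move=> x /= /forallNP hx n _; apply: contrapT; exact: hx.
apply/eqP; rewrite eq_le measure_ge0 andbT; apply/lee_addgt0Pr => e e0.
rewrite add0e; have half1 : `|2^-1 : R| < 1 by rewrite ger0_norm ?invr_ge0// invf_lt1// ltr1n.
have /cvgrPdist_lt /(_ e e0)[n _ hn] := cvg_expr half1.
have [k nk hk] := h n; rewrite (@le_trans _ _ (mu (A k)))//.
  by apply: le_measure; rewrite ?inE// => x; exact.
rewrite (le_trans hk)// lee_fin ltW//; have := hn k nk.
by rewrite sub0r normrN ger0_norm// exprn_ge0// invr_ge0.
Qed.

(** * Union bounds over chains and almost sure boundedness for fixed points *)

Section Percolation.
Context {R : realType} {d : nat} (P : probability (Nspace R d) R).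
Context (K eta : R) (M : nat).
(** [m] is the radius in [blocked_open], [s] the separation giving independence and distinct edges,
    and [C] the number of choices for one jump. *)
Let m := (3 * d.+1)%N.
Let s := (2 * m).+1.
Let C := ((2 * s.+1).+1 ^ d)%N.
Hypothesis K0 : 0 < K.
Hypothesis eta_ge0 : 0 <= eta.
Hypothesis eta_le : C%:R * eta <= 4^-1.

(** [C ^ n] counts chains and [2 ^ n.+1] subsets of a chain. The product is [2 * eta] times the
    [n]-th power of [2 * C * eta]; these factors are at most 1 and 1/2. *)
Lemma geometric_bound n (l : nat) : (l <= C ^ n * 2 ^ n.+1)%N ->
  l%:R * eta ^+ n.+1 <= 2^-1 ^+ n.
Proof.
move=> hl; have C1 : (1 <= C)%N by rewrite expn_gt0.
have eC : eta <= C%:R * eta by rewrite ler_peMl// ler1n.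
rewrite (@le_trans _ _ ((C ^ n * 2 ^ n.+1)%:R * eta ^+ n.+1))//.
  by rewrite ler_wpM2r ?exprn_ge0// ler_nat.
have -> : (C ^ n * 2 ^ n.+1)%:R * eta ^+ n.+1 = (2 * eta) * (2 * (C%:R * eta)) ^+ n.
  by rewrite natrM !natrX !exprMn !exprS; ring.
have h2 : 2 * (C%:R * eta) <= 2^-1 by move: (C%:R * eta) eta_le => a ?; lra.
have eta4 : eta <= 4^-1 := le_trans eC eta_le.
have h1 : 0 <= 2 * eta <= 1.
  by move: eta4 eta_ge0; move: (eta) => e e4 e0; apply/andP; split; [rewrite mulr_ge0|lra].
rewrite (@le_trans _ _ (1 * 2^-1 ^+ n))//; last by rewrite mul1r.
rewrite ler_pM//; [by case/andP: h1|by rewrite exprn_ge0// !mulr_ge0|by case/andP: h1|].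
by apply: lerXn2r => //; rewrite nnegrE ?invr_ge0// !mulr_ge0.
Qed.

(** Only half of the cells of a chain contribute a factor, so each must cost [eta ^+ 2]. *)
Lemma power_bound (a : R) (j n : nat) : 0 <= a <= eta ^+ 2 -> (n <= 2 * j)%N ->
  a ^+ j <= eta ^+ n.
Proof.
move=> /andP[a0 ae] nj; have C1 : (1 <= C)%N by rewrite expn_gt0.
have eta1 : eta <= 1.
  by rewrite (@le_trans _ _ (C%:R * eta)) ?ler_peMl ?ler1n// (le_trans eta_le)// invf_le1// ler1n.
rewrite (@le_trans _ _ (eta ^+ (2 * j)))//; last exact: ler_wiXn2l.
by rewrite exprM; apply: lerXn2r; rewrite ?nnegrE// exprn_ge0.
Qed.

Local Notation bad v :=
  (@count_event R d (block K 0 v) (fun n : nat => n = 0%N \/ (M < n)%N)).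

Definition bad_near v : set (Nspace R d) := \bigcup_(v' in [set` ball_cells m v]) bad v'.

Lemma bad_nearN xi v : ~ bad_near v xi -> good_cell xi K M m v.
Proof. by move=> h v' vv' b; apply: h; exists v' => //=; rewrite mem_ball_cells. Qed.

Lemma measurable_bad_near v : measurable (bad_near v).
Proof.
apply: fin_bigcup_measurable => [|v' _]; first exact: finite_seq.
by apply: measurable_count_event; exact: borel_block.
Qed.

(** The bit mask selects the cells to be bad, at least half of them, so that [half_bad] is a finite
    union over fixed separated lists. *)
Definition half_chains (a : 'rV[int]_d) n : seq (seq 'rV[int]_d * bitseq) :=
  [seq cb <- [seq (c, tval b) | c <- chains s n a, b <- enum {: n.+1.-tuple bool}] |
    separated s cb.1 && (n.+1 <= 2 * size (mask cb.2 cb.1))%N].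

Definition half_bad a n : set (Nspace R d) :=
  \bigcup_(cb in [set` half_chains a n]) \bigcap_(v in [set` mask cb.2 cb.1]) bad_near v.

Lemma size_half_chains a n : (size (half_chains a n) <= C ^ n * 2 ^ n.+1)%N.
Proof.
rewrite size_filter (leq_trans (count_size _ _))// size_allpairs size_chains.
by rewrite -cardE card_tuple card_bool.
Qed.

Lemma measurable_half_bad a n : measurable (half_bad a n).
Proof.
apply: fin_bigcup_measurable => [|cb _]; first exact: finite_seq.
by apply: fin_bigcap_measurable => [|v _]; [exact: finite_seq|exact: measurable_bad_near].
Qed.

(** The mask marking the cells in [bad_near] would witness [half_bad] if it kept half of the chain;
    the unmarked cells are good. *)
Lemma half_badN xi a n c : ~ half_bad a n xi -> c \in chains s n a -> separated s c ->
  (n.+1 <= 2 * size [seq v <- c | `[< good_cell xi K M m v >]])%N.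
Proof.
move=> nh ca sc; have sn := size_mem_chains ca.
have sb : size [seq `[< bad_near v xi >] | v <- c] == n.+1 by rewrite size_map sn.
have : (2 * size (mask (tval (Tuple sb)) c) < n.+1)%N.
  rewrite ltnNge; apply/negP => h; apply: nh; exists (c, tval (Tuple sb)).
    rewrite /= mem_filter /= sc h /=; apply/allpairsP; exists (c, Tuple sb).
    by rewrite mem_enum.
  by move=> v; rewrite /= -filter_mask mem_filter => /andP[/asboolP].
rewrite /= -filter_mask !size_filter.
have := count_predC (fun v => `[< bad_near v xi >]) c.
have : (count (predC (fun v => `[< bad_near v xi >])) c <=
        count (fun v => `[< good_cell xi K M m v >]) c)%N.
  by apply: sub_count => v /= /asboolPn /bad_nearN h; exact/asboolP.
rewrite sn; lia.
Qed.

Lemma half_bad_le (L : R) a n : 0 < L -> L <= K ->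
  independent_beyond P L ->
  (forall v, (P (bad v) <= (eta ^+ 2 / ((2 * m).+1 ^ d)%:R)%:E)%E) ->
  (P (half_bad a n) <= (2^-1 ^+ n)%:E)%E.
Proof.
move=> L0 LK indep Pbad.
(* The number of cells in the neighbourhood cancels the denominator in [Pbad]. *)
have Pnear v : (P (bad_near v) <= (eta ^+ 2)%:E)%E.
  apply: le_trans (measure_bigcup_seq _ (fun v' _ => Pbad v')) _.
    by move=> v' _; apply: measurable_count_event; exact: borel_block.
  by rewrite size_ball_cells mulrC divfK// pnatr_eq0 expn_eq0.
apply: (@le_trans _ _ ((size (half_chains a n))%:R * eta ^+ n.+1)%:E); last first.
  by rewrite lee_fin geometric_bound// size_half_chains.
apply: measure_bigcup_seq => cb.
  move=> _; apply: fin_bigcap_measurable => [|v _]; first exact: finite_seq.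
  exact: measurable_bad_near.
rewrite mem_filter => /andP[/andP[sc hc] _].
apply: (@le_trans _ _ ((eta ^+ 2) ^+ size (mask cb.2 cb.1))%:E); last first.
  by rewrite lee_fin power_bound// lexx exprn_ge0.
apply: (separated_events_le indep L0 LK (m := m)) => //.
- exact: measurable_bad_near.
- move=> v A xi vA; apply/propext; split=> -[v' vv'].
    rewrite count_event_restrict; first by exists v'.
    by move=> x xv'; apply: vA; move: vv' xv'; rewrite /block/= mem_ball_cells near_cell0 => + /eqP <-.
  exists v' => //; rewrite count_event_restrict//.
  by move=> x xv'; apply: vA; move: vv' xv'; rewrite /block/= mem_ball_cells near_cell0 => + /eqP <-.
- by apply: subseq_pairwise sc; exact: mask_subseq.
Qed.

Context (xi : Nspace R d) {dO : measure_display} {Omega : measurableType dO}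
  (mu : probability Omega R) (p : R) (W : set 'rV[R]_d -> Omega -> bool).
Hypothesis iidW : iid_bernoulli_edges (pts xi) p mu W.
Hypothesis p0 : 0 <= p.
Hypothesis p_le : (((2 * m).+1 ^ d * M) ^ 2)%:R * p <= eta ^+ 2.

Definition open_chain a n : set Omega :=
  \bigcup_(c in [set` [seq c <- chains s n a | separated s c]])
    \bigcap_(v in [set` [seq v <- c | `[< good_cell xi K M m v >]]]) open_in xi K W m v.

Lemma measurable_open_chain a n : measurable (open_chain a n).
Proof.
apply: fin_bigcup_measurable => [|c _]; first exact: finite_seq.
apply: fin_bigcap_measurable => [|v /=]; first exact: finite_seq.
rewrite mem_filter => /andP[/asboolP gv _].
exact: (measurable_open_in K0 iidW gv).
Qed.

(** Estimate for fixed points: at least half of the cells of each chain are good, and by [p_le] an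
    open edge near each costs at most [eta ^+ 2]. *)
Lemma open_chain_le a n : ~ half_bad a n xi -> (mu (open_chain a n) <= (2^-1 ^+ n)%:E)%E.
Proof.
move=> nh; set l := [seq c <- chains s n a | separated s c].
apply: (@le_trans _ _ ((size l)%:R * eta ^+ n.+1)%:E); last first.
  rewrite lee_fin geometric_bound// size_filter (leq_trans (count_size _ _))//.
  by rewrite size_chains leq_pmulr// expn_gt0.
apply: measure_bigcup_seq => c; rewrite mem_filter => /andP[sc ca].
  apply: fin_bigcap_measurable => [|v /=]; first exact: finite_seq.
  rewrite mem_filter => /andP[/asboolP gv _].
  exact: (measurable_open_in K0 iidW gv).
apply: le_trans (open_in_le K0 iidW p0 (m := m) (M := M) _ _) _.
- by apply: subseq_pairwise sc; exact: filter_subseq.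
- by move=> v; rewrite mem_filter => /andP[/asboolP].
rewrite lee_fin; apply: power_bound; last exact: half_badN nh ca sc.
by apply/andP; split; first exact: mulr_ge0.
Qed.

Lemma unbounded_open_chain w x n : ~ ebounded (component (pts xi) W w x) ->
  open_chain (cell_of K x) n w.
Proof.
move=> /(unbounded_chain K0 s n)[c [ca sc bc]].
exists c; first by rewrite /= mem_filter sc.
move=> v /=; rewrite mem_filter => /andP[/asboolP gv /bc bv].
by have [e e1 e2] := blocked_open K0 gv bv; exists e.
Qed.

Lemma ae_bounded_components : (forall a n, exists2 k, (n <= k)%N & ~ half_bad a k xi) ->
  {ae mu, forall w, bounded_components (pts xi) W w}.
Proof.
move=> hxi.
(* At [half_bad] lengths [A] is the whole space, so an unbounded component starting in cell [a] lies
   in every [A a n]. Indexing by the starting cell, not the point, keeps the family countable. *)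
pose A a n := if `[< half_bad a n xi >] then setT else open_chain a n.
have : {ae mu, forall w, forall a, exists n, ~ A a n w}.
  apply: ae_countable => a; apply: negligible_geometric => n.
    by rewrite /A; case: ifP => // _; exact: measurable_open_chain.
  have [k nk hk] := hxi a n; exists k => //.
  by rewrite /A; case: asboolP => // _; exact: open_chain_le.
apply: filterS => w hw x _; apply: contrapT => unb.
have [n] := hw (cell_of K x); apply; rewrite /A; case: ifP => // _.
exact: unbounded_open_chain.
Qed.

End Percolation.

(** * Degenerate cases, choice of constants and conclusion *)

Unset Implicit Arguments.

Theorem theorem6p4 (R : realType) (d : nat) (P : probability (Nspace R d) R) :
  stationary P -> finite_intensity P -> finite_range_dependence P ->
  exists pstar : R, 0 < pstar < 1 /\
    forall p : R, 0 <= p <= pstar ->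
      {ae P, forall xi : Nspace R d, Npol (pts xi) ->
         forall (dO : measure_display) (Omega : measurableType dO)
                (mu : probability Omega R) (W : set 'rV[R]_d -> Omega -> bool),
           iid_bernoulli_edges (pts xi) p mu W ->
           {ae mu, forall w : Omega, bounded_components (pts xi) W w}}.
Proof.
move=> statP _ [L [L0 indep]].
have half01 : 0 < (2^-1 : R) < 1 by rewrite invr_gt0 ltr0n invf_lt1 ?ltr1n.
(* In dimension 0 space is a single point, so any threshold works. *)
have [d0|d0] := posnP d.
  exists 2^-1; split => // p _; apply: aeW => xi _ dO Omega mu W _.
  apply: aeW => w x _; exists 0 => y _.
  by rewrite dist2E big1// => i _; have := ltn_ord i; rewrite [X in (_ < X)%N]d0.
have [P1|P1] := eqVneq (P (count_event (block 1 0 0) (eq 0%N))) 1%E.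
  exists 2^-1; split => // p _; apply: filterS (ae_empty statP P1) => xi xi0 _ dO Omega mu W _.
  by apply: aeW => w x; rewrite xi0.
have {}P1 : (P (count_event (block 1 0 0) (eq 0%N)) < 1)%E.
  rewrite lt_neqAle P1 probability_le1//.
  by apply: measurable_count_event; exact: borel_block.
pose m := (3 * d.+1)%N; pose s := (2 * m).+1.
pose C := ((2 * s.+1).+1 ^ d)%N; pose eta : R := (4 * C%:R)^-1.
have C0 : 0 < C%:R :> R by rewrite ltr0n expn_gt0.
have eta0 : 0 < eta by rewrite invr_gt0 mulr_gt0.
have eta_le : C%:R * eta <= 4^-1 by rewrite /eta invfM mulrCA divff ?gt_eqF// mulr1.
have eta1 : eta < 1.
  have C1 : 1 <= C%:R :> R by rewrite ler1n expn_gt0.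
  by rewrite invf_lt1 ?mulr_gt0//; move: (C%:R) C1 => c c1; lra.
have [K [M [K0 LK hM]]] : exists K M, [/\ 0 < K, L <= K & forall v,
    (P (count_event (block K 0 v) (fun n => n = 0%N \/ (M < n)%N)) <=
      (eta ^+ 2 / ((2 * m).+1 ^ d)%:R)%:E)%E].
  apply: exists_scale => //; rewrite divr_gt0 ?exprn_gt0// ltr0n expn_gt0//.
(* [T] bounds the number of edges near a good cell; [T + 1] keeps the threshold well defined when
   [M = 0] and makes it less than 1. *)
pose T : R := (((2 * m).+1 ^ d * M) ^ 2)%:R.
have T0 : 0 < T + 1 by rewrite ltr_wpDl.
exists (eta ^+ 2 / (T + 1)); split.
  rewrite divr_gt0 ?exprn_gt0//= ltr_pdivrMr// mul1r (@lt_le_trans _ _ 1)//.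
    by rewrite exprn_ilt1// ltW.
  by rewrite lerDr.
move=> p /andP[p0 p_le].
have {}p_le : T * p <= eta ^+ 2.
  rewrite (@le_trans _ _ ((T + 1) * p))//; first by rewrite ler_wpM2r// lerDl.
  by rewrite mulrC -ler_pdivlMr.
(* The shift by [an.2] yields lengths that are not [half_bad] beyond every given [n], for every
   starting cell. *)
have : {ae P, forall xi, forall an : 'rV[int]_d * nat,
    exists k, ~ half_bad K M an.1 (an.2 + k) xi}.
  apply: ae_countable => -[a n] /=; apply: negligible_geometric => k.
    exact: measurable_half_bad.
  exists k => //; apply: le_trans (half_bad_le K0 (ltW eta0) eta_le _ _ L0 LK indep hM) _ => //.
  by rewrite lee_fin; apply: ler_wiXn2l; rewrite ?invr_ge0// ?invf_le1 ?ler1n// leq_addl.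
apply: filterS => xi hxi _ dO Omega mu W iidW.
apply: (@ae_bounded_components _ _ K eta M K0 (ltW eta0) eta_le xi _ _ mu p W iidW p0 p_le) => a n.
have [k hk] := hxi (a, n); exists (n + k)%N => //; exact: leq_addr.
Qed.
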